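(* Let $P_1,\dots,P_k$ be equivalent probability measures on $(\Omega,\mathcal F)$ such that all densities $\frac{dP_i}{dP_l}$, $i,l=1,\dots,k$, are $\mathcal F_1$-measurable and $P_1\left(\frac{dP_i}{dP_l}>0\right)=1$, and let $M=\{\sum_{i=1}^k\alpha_iP_i:\ \alpha_i\ge0,\ \sum_{i=1}^k\alpha_i=1\}$. Let $\xi$ be a nonnegative random variable with $\max_{1\le i\le k}E^{P_i}\xi<\infty$, and let $$f_m=\operatorname{ess\,sup}_{P\in M}E^P\{\xi|\mathcal F_m\},\qquad m\ge 0 .$$ Then necessary and sufficient conditions for the super-martingale $\{f_m,\mathcal F_m\}_{m=0}^\infty$ (relative to $M$) to be local regular are: it is uniformly integrable relative to the set of measures $P_1,\dots,P_k$, and $$E^{P_i}\xi=f_0,\qquad i=1,\dots,k.$$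
   Context: Let $(\Omega,\mathcal F)$ be a measurable space with a filtration $\mathcal F_0\subset\mathcal F_1\subset\dots\subset\mathcal F$, where $\mathcal F_0=\{\emptyset,\Omega\}$ and $\mathcal F=\sigma(\bigcup_{n\ge1}\mathcal F_n)$. $E^P$ denotes expectation (or conditional expectation) with respect to $P$. An adapted process $\{f_m\}_{m=0}^\infty$ is a super-martingale relative to a convex set $M$ of equivalent measures if $E^P|f_m|<\infty$ for all $m\ge1$, $P\in M$, and $E^P\{f_m|\mathcal F_k\}\le f_k$ for all $0\le k\le m$ and all $P\in M$. A super-martingale $\{f_m,\mathcal F_m\}_{m=0}^\infty$ relative to $M$ is local regular if $\sup_{P\in M}E^P|f_m|<\infty$ for all $m\ge1$ and there exists an adapted nonnegative increasing (i.e. non-decreasing in $m$) process $\{g_m,\mathcal F_m\}_{m=0}^\infty$ with $g_0=0$ and $\sup_{P\in M}E^P|g_m|<\infty$ for $m\ge1$, such that $\{f_m+g_m,\mathcal F_m\}_{m=0}^\infty$ is a martingale relative to every measure from $M$. *)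

(* Defs.v *)
From mathcomp Require Export all_boot all_order all_algebra.
From mathcomp Require Export all_classical all_reals all_analysis.

Set Implicit Arguments.
Unset Strict Implicit.
Unset Printing Implicit Defensive.

Import Order.TTheory GRing.Theory Num.Theory.
Import numFieldNormedType.Exports.

Local Open Scope classical_set_scope.
Local Open Scope ring_scope.
Local Open Scope charge_scope.
Local Open Scope ereal_scope.

(* A sub-sigma-algebra of a measurableType T is represented by its set of
   events G : set (set T); since G is assumed to be a sigma-algebra, the
   measurable sets of [g_sigma_algebraType G] are exactly the elements of G. *)

Definition measurable_wrt d (T : measurableType d) (R : realType)
    (G : set (set T)) (f : T -> R) : Prop :=
  measurable_fun [set: g_sigma_algebraType G] (f : g_sigma_algebraType G -> R).

Definition filtration d (T : measurableType d) (F : nat -> set (set T)) : Prop :=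
  [/\ forall n, sigma_algebra [set: T] (F n),
      forall n, F n `<=` @measurable d T &
      forall n, F n `<=` F n.+1].

Definition adapted d (T : measurableType d) (R : realType)
    (F : nat -> set (set T)) (f : nat -> T -> R) : Prop :=
  forall n, measurable_wrt (F n) (f n).

(* Y is a version of E^P{X | G}. *)
Definition is_cond_exp d (T : measurableType d) (R : realType)
    (P : probability T R) (G : set (set T)) (X Y : T -> R) : Prop :=
  [/\ P.-integrable setT (EFin \o X),
      measurable_wrt G Y,
      P.-integrable setT (EFin \o Y) &
      forall A, G A -> \int[P]_(x in A) (Y x)%:E = \int[P]_(x in A) (X x)%:E].

(* f is a version of the P-essential supremum of the family S of random
   variables: the P-a.s. least random variable dominating P-a.s. each member
   of S.  (The library's [ess_sup] is the essential supremum of one function,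
   a number.) *)
Definition is_ess_sup d (T : measurableType d) (R : realType)
    (P : probability T R) (S : set (T -> R)) (f : T -> R) : Prop :=
  [/\ measurable_fun setT f,
      forall h, S h -> \forall x \ae P, (h x <= f x)%R &
      forall g, measurable_fun setT g ->
        (forall h, S h -> \forall x \ae P, (h x <= g x)%R) ->
        \forall x \ae P, (f x <= g x)%R].

(* Q is only required to agree with the mixture on events, the values of a
   measure on non-measurable sets being irrelevant. *)
Definition convex_hull d (T : measurableType d) (R : realType) (k : nat)
    (P : 'I_k -> probability T R) : set (probability T R) :=
  [set Q | exists a : 'I_k -> R,
    [/\ forall i, (0 <= a i)%R, (\sum_(i < k) a i)%R = 1%R &
        forall A, measurable A -> Q A = \sum_(i < k) (a i)%:E * P i A]].

(* phi is a version of dQ/dP. *)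
Definition is_density d (T : measurableType d) (R : realType)
    (Q P : probability T R) (phi : T -> R) : Prop :=
  ae_eq P setT ('d (charge_of_finite_measure Q) '/d P) (EFin \o phi).

Definition supermartingale d (T : measurableType d) (R : realType)
    (M : set (probability T R)) (F : nat -> set (set T)) (f : nat -> T -> R) :
    Prop :=
  [/\ adapted F f,
      forall m Q, (1 <= m)%N -> M Q -> 'E_Q[fun x => `|f m x|%R] < +oo &
      forall j m Q, (j <= m)%N -> M Q ->
        exists2 h, is_cond_exp Q (F j) (f m) h &
                   \forall x \ae Q, (h x <= f j x)%R].

Definition martingale d (T : measurableType d) (R : realType)
    (P : probability T R) (F : nat -> set (set T)) (f : nat -> T -> R) : Prop :=
  [/\ adapted F f,
      forall m, P.-integrable setT (EFin \o f m) &
      forall j m, (j <= m)%N -> is_cond_exp P (F j) (f m) (f j)].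

Definition bounded_in_mean d (T : measurableType d) (R : realType)
    (M : set (probability T R)) (f : nat -> T -> R) : Prop :=
  forall m, (1 <= m)%N ->
    ereal_sup [set 'E_Q[fun x => `|f m x|%R] | Q in M] < +oo.

Definition local_regular d (T : measurableType d) (R : realType)
    (M : set (probability T R)) (F : nat -> set (set T)) (f : nat -> T -> R) :
    Prop :=
  [/\ supermartingale M F f, bounded_in_mean M f &
      exists g : nat -> T -> R,
        [/\ adapted F g,
            (forall m x, (0 <= g m x)%R),
            (forall x, nondecreasing_seq (g ^~ x)),
            (forall x, g 0%N x = 0%R) &
            bounded_in_mean M g /\
            (forall Q, M Q -> martingale Q F (fun m x => (f m x + g m x)%R))]].

(* sup_(P in M) sup_m E^P[ |f_m| ; |f_m| > c ] --> 0 as c --> +oo *)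
Definition uniformly_integrable d (T : measurableType d) (R : realType)
    (M : set (probability T R)) (f : nat -> T -> R) : Prop :=
  forall eps : R, (0 < eps)%R -> exists c : R, forall Q m, M Q ->
    \int[Q]_(x in [set x | (c < `|f m x|)%R]) `|f m x|%:E <= eps%:E.

(* Main.v *)
Require Import Defs.
From mathcomp Require Import measurable_realfun.

(* Since the densities are F_1-measurable, every measure of the convex hull has
   the same conditional expectations of xi given F_m, m >= 1; hence f_m is a
   version of all of them, and in particular f is a martingale from time 1 on
   and is uniformly integrable in all cases.  At time 0, f_0 = max_i E^{P_i} xi.
   If f + g is a martingale for all P_i, then E^{P_i} xi + E^{P_i} g_1 = f_0;
   for a maximizing i this forces g_1 = 0 a.s., and by equivalence of the
   measures E^{P_i} xi = f_0 for every i.  Conversely g = 0 is a witness of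
   local regularity. *)

Set Implicit Arguments.
Unset Strict Implicit.
Unset Printing Implicit Defensive.

Import Order.TTheory GRing.Theory Num.Theory.
Import numFieldNormedType.Exports HBNNSimple.

Local Open Scope classical_set_scope.
Local Open Scope ring_scope.
Local Open Scope ereal_scope.

(** * Elementary facts on integrals over events *)

Lemma integral_indicM d (T : measurableType d) (R : realType)
    (mu : {measure set T -> \bar R}) (A : set T) (u : T -> R) :
  \int[mu]_(x in A) (u x)%:E = \int[mu]_x (\1_A x * u x)%:E.
Proof.
rewrite integral_mkcond; apply: eq_integral => x _.
by rewrite epatch_indic EFinM muleC.
Qed.

Lemma ae_eq_integrable d (T : measurableType d) (R : realType)
    (mu : {measure set T -> \bar R}) (u v : T -> \bar R) :
  measurable_fun setT v -> ae_eq mu setT u v ->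
  mu.-integrable setT u -> mu.-integrable setT v.
Proof.
move=> mv uv /integrableP[mu_ uoo]; apply/integrableP; split=> //.
have <- : \int[mu]_x `|u x| = \int[mu]_x `|v x| => //.
apply: ae_eq_integral => //.
- exact: measurableT_comp.
- exact: measurableT_comp.
- by apply: filterS uv => x /= uv xT; rewrite uv.
Qed.

(** * Weighted integrals of functions that agree on a sub-sigma-algebra *)

Section sub_sigma_algebra.
Context d (T : measurableType d) (R : realType) (G : set (set T)).
Hypotheses (sG : sigma_algebra setT G) (GT : G `<=` @measurable d T).

Lemma measurable_sub_sigma (A : set T) :
  measurable (A : set (g_sigma_algebraType G)) <-> G A.
Proof. by rewrite /measurable/= (sigma_algebra_id sG). Qed.

Lemma measurable_wrtP (f : T -> R) :
  measurable_wrt G f <-> (forall B, measurable B -> G (f @^-1` B)).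
Proof.
split=> [mf B mB|mf _ B mB].
  by have := mf measurableT B mB; rewrite setTI measurable_sub_sigma.
by rewrite setTI; apply/measurable_sub_sigma; exact: mf.
Qed.

Lemma measurable_wrt_fun (f : T -> R) :
  measurable_wrt G f -> measurable_fun setT f.
Proof. by move=> /measurable_wrtP mf _ B mB; rewrite setTI; exact/GT/mf. Qed.

(** First stage of the standard machine: a weight that is simple with respect to [G] has its level
    sets in [G], so the weighted integral depends only on integrals of [u] over events of [G]. *)
Lemma ge0_integral_nnsfun (h : {nnsfun g_sigma_algebraType G >-> R})
    (mu : {measure set T -> \bar R}) (u : T -> R) :
  measurable_fun setT u -> (forall x, 0 <= u x)%R ->
  \int[mu]_x ((h : T -> R) x * u x)%:E =
  \sum_(y \in range h) y%:E * \int[mu]_(x in h @^-1` [set y]) (u x)%:E.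
Proof.
move=> mu_ u0.
have mpre y : measurable ((h : T -> R) @^-1` [set y]).
  apply: GT; apply/measurable_sub_sigma.
  exact: (measurable_sfunP h (measurable_set1 y)).
have mindic y : measurable_fun setT (\1_((h : T -> R) @^-1` [set y]) : T -> R).
  exact: measurable_indic.
have mt y : measurable_fun setT
    (fun x => y%:E * (\1_((h : T -> R) @^-1` [set y]) x * u x)%:E).
  apply/emeasurable_funM => //; apply/measurable_EFinP.
  exact: measurable_funM.
transitivity (\int[mu]_x (\sum_(y \in range h)
    y%:E * (\1_((h : T -> R) @^-1` [set y]) x * u x)%:E)).
  apply: eq_integral => x _.
  rewrite (fimfunE h x) EFinM -fsumEFin// muleC ge0_mule_fsumr.
    by apply: eq_fsbigr => y _; rewrite -!EFinM mulrCA (mulrC (u x)).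
  by move=> y; exact: (nnfun_muleindic_ge0 h y x).
rewrite ge0_integral_fsum//; last first.
  move=> y x _; rewrite -EFinM mulrA EFinM mule_ge0 ?lee_fin//.
  exact: (nnfun_muleindic_ge0 h y x).
apply: eq_fsbigr => y; rewrite inE => -[x _ <-].
rewrite ge0_integralZl//.
- congr (_ * _); rewrite [RHS]integral_mkcond; apply: eq_integral => z _.
  by rewrite epatch_indic EFinM muleC.
- by apply/measurable_EFinP; exact: measurable_funM.
- by move=> z _; rewrite lee_fin mulr_ge0.
- by rewrite lee_fin.
Qed.

(** Second stage: [w] is the increasing limit of [G]-simple functions, for which both sides agree
    level by level; monotone convergence passes to the limit. Two measures are allowed so that the
    same fact also yields change of measure. *)
Let ge0_integralM_agreeT (mu nu : {measure set T -> \bar R}) (u v w : T -> R) :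
  measurable_fun setT u -> (forall x, 0 <= u x)%R ->
  measurable_fun setT v -> (forall x, 0 <= v x)%R ->
  measurable_wrt G w -> (forall x, 0 <= w x)%R ->
  (forall A, G A -> \int[mu]_(x in A) (u x)%:E = \int[nu]_(x in A) (v x)%:E) ->
  \int[mu]_x (w x * u x)%:E = \int[nu]_x (w x * v x)%:E.
Proof.
move=> mu_ u0 mv v0 mw w0 uv.
have mwE := (measurable_EFinP _ _).2 mw.
pose h n : {nnsfun g_sigma_algebraType G >-> R} := nnsfun_approx measurableT mwE n.
have mh n : measurable_fun setT (h n : T -> R).
  apply: measurable_wrt_fun; exact: (@measurable_funPT _ _ _ _ (h n)).
have approx (m : {measure set T -> \bar R}) (t : T -> R) :
    measurable_fun setT t -> (forall x, 0 <= t x)%R ->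
  \int[m]_x (w x * t x)%:E = limn (fun n => \int[m]_x ((h n : T -> R) x * t x)%:E).
  move=> mt t0; rewrite -monotone_convergence//.
  - apply: eq_integral => x _; apply/esym/cvg_lim => //.
    under eq_fun do rewrite EFinM.
    rewrite EFinM; apply: cvgeZr => //.
    by apply: (cvg_nnsfun_approx measurableT mwE) => // y _; rewrite lee_fin.
  - by move=> n; apply/measurable_EFinP; exact: (measurable_funM (mh n)).
  - by move=> n x _; rewrite lee_fin mulr_ge0.
  - move=> x _ m' n' mn; rewrite lee_fin ler_wpM2r//.
    by have /lefP := nd_nnsfun_approx measurableT mwE mn; exact.
rewrite !approx//; congr (limn _); apply/funext => n.
rewrite !ge0_integral_nnsfun//; apply: eq_fsbigr => y _; congr (_ * _).
apply: uv; apply/measurable_sub_sigma.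
exact: (measurable_sfunP (h n) (measurable_set1 y)).
Qed.

Lemma ge0_integralM_agree (mu nu : {measure set T -> \bar R}) (u v w : T -> R)
    (A : set T) :
  measurable_fun setT u -> (forall x, 0 <= u x)%R ->
  measurable_fun setT v -> (forall x, 0 <= v x)%R ->
  measurable_wrt G w -> (forall x, 0 <= w x)%R ->
  (forall B, G B -> \int[mu]_(x in B) (u x)%:E = \int[nu]_(x in B) (v x)%:E) ->
  G A ->
  \int[mu]_(x in A) (w x * u x)%:E = \int[nu]_(x in A) (w x * v x)%:E.
Proof.
(* The event is absorbed into the weight, which becomes [\1_A * w] and stays [G]-measurable. *)
move=> mu_ u0 mv v0 mw w0 uv GA; rewrite [LHS]integral_indicM [RHS]integral_indicM.
under eq_integral do rewrite mulrA.
under [RHS]eq_integral do rewrite mulrA.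
apply: ge0_integralM_agreeT => // [|x]; last exact: mulr_ge0.
apply: measurable_funM => //.
by apply: measurable_indic; exact/measurable_sub_sigma.
Qed.

End sub_sigma_algebra.

(** The preceding agreement result with the full sigma-algebra as [G], the integrand 1 under [nu]
    and the integrand [w] under [mu]. *)
Lemma integral_density d (T : measurableType d) (R : realType)
    (mu nu : {measure set T -> \bar R}) (w u : T -> R) (A : set T) :
  measurable_fun setT w -> (forall x, 0 <= w x)%R ->
  (forall B, measurable B -> nu B = \int[mu]_(x in B) (w x)%:E) ->
  measurable_fun setT u -> (forall x, 0 <= u x)%R -> measurable A ->
  \int[nu]_(x in A) (u x)%:E = \int[mu]_(x in A) (u x * w x)%:E.
Proof.
move=> mw w0 nuE mu_ u0 mA.
have sT := sigma_algebra_measurable T.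
rewrite -(ge0_integralM_agree sT _ (mu := nu) (u := cst 1%R))//.
- by under [RHS]eq_integral do rewrite mulr1.
- apply/(measurable_wrtP sT) => B mB.
  by rewrite -[X in measurable X]setTI; exact: mu_.
- by move=> B mB; rewrite -nuE// -[RHS]mul1e -integral_cst.
Qed.

(** * Versions of conditional expectations and change of measure *)

Section cond_exp.
Context d (T : measurableType d) (R : realType).
Variable G : set (set T).
Hypotheses (sG : sigma_algebra setT G) (GT : G `<=` @measurable d T).
Implicit Types (P Q : probability T R) (X Y Z : T -> R).

(** The event where [Y' < Y] lies in [G], so the integral of [Y - Y'] over it equals that of
    [X - X'], which is at most 0. The integrand being positive there, the event is null. *)
Lemma cond_exp_le P X X' Y Y' : (forall x, X x <= X' x)%R ->
  is_cond_exp P G X Y -> is_cond_exp P G X' Y' ->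
  \forall x \ae P, (Y x <= Y' x)%R.
Proof.
move=> XX' [iX mY iY YX] [iX' mY' iY' YX'].
have mYT := measurable_wrt_fun sG GT mY.
have mYT' := measurable_wrt_fun sG GT mY'.
pose A := [set x | (Y' x < Y x)%R].
have GA : G A.
  apply/(measurable_sub_sigma sG).
  have := measurable_fun_ltr mY' mY measurableT (I : measurable [set true]).
  by rewrite setTI.
have mA := GT GA.
have iS Z : P.-integrable setT (EFin \o Z) -> P.-integrable A (EFin \o Z).
  by apply: integrableS.
have : ae_eq P A (fun x => (Y x - Y' x)%:E) (cst 0).
  apply/(ae_eq_integral_abs _ mA).
    by apply/measurable_EFinP/measurable_funTS; exact: measurable_funB.
  apply/eqP; rewrite eq_le integral_ge0 ?andbT//.
  rewrite (eq_integral (fun x => (Y x)%:E - (Y' x)%:E)); last first.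
    by move=> x; rewrite inE /A/= => YY; rewrite /= ger0_norm ?EFinB// subr_ge0 ltW.
  rewrite integralB_EFin//; [|exact: iS..].
  rewrite YX// YX'// sube_le0; apply: le_integral => //; [exact: iS..|].
  by move=> x _; rewrite lee_fin.
apply: filterS => x YY'; rewrite leNgt; apply/negP => Ax.
by have [] := YY' Ax => /eqP; rewrite subr_eq0 gt_eqF.
Qed.

Lemma cond_exp_ae_eq P X Y Z : is_cond_exp P G X Y -> measurable_wrt G Z ->
  (\forall x \ae P, Y x = Z x) -> is_cond_exp P G X Z.
Proof.
move=> [iX mY iY YX] mZ YZ.
have mYT := measurable_wrt_fun sG GT mY.
have mZT := measurable_wrt_fun sG GT mZ.
split=> //.
  apply: ae_eq_integrable iY; first exact/measurable_EFinP.
  by apply: filterS YZ => x /= ->.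
move=> A GA; rewrite -YX//; apply: ae_eq_integral; first exact: GT.
- exact/measurable_EFinP/measurable_funTS.
- exact/measurable_EFinP/measurable_funTS.
- by apply: filterS YZ => x /= ->.
Qed.

Lemma cond_exp_unique P X Y Y' : is_cond_exp P G X Y -> is_cond_exp P G X Y' ->
  \forall x \ae P, Y x = Y' x.
Proof.
move=> XY XY'; have le := @cond_exp_le P X X.
apply: filterS2 (le _ _ (fun=> lexx _) XY XY') (le _ _ (fun=> lexx _) XY' XY).
by move=> x YY' Y'Y; apply/eqP; rewrite eq_le YY'.
Qed.

Lemma cond_exp_cst P c : is_cond_exp P G (cst c) (cst c).
Proof.
by split=> //; [exact: finite_measure_integrable_cst|exact: measurable_cst|
  exact: finite_measure_integrable_cst].
Qed.

Lemma null_dominates_ae (mu nu : {measure set T -> \bar R}) (p : T -> Prop) :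
  nu `<< mu -> (\forall x \ae mu, p x) -> \forall x \ae nu, p x.
Proof.
move=> /null_content_dominatesP numu [A [mA A0 pA]].
by exists A; split => //; exact: numu.
Qed.

(** The density is itself [G]-measurable, so it acts as a weight: over an event of [G], the
    [Q]-integrals of [Y] and [X] are the [P]-integrals of [w Y] and [w X], which agree. *)
Lemma cond_exp_density P Q (w : T -> R) X Y :
  measurable_wrt G w -> (forall x, 0 <= w x)%R ->
  (forall A, measurable A -> Q A = \int[P]_(x in A) (w x)%:E) ->
  (forall x, 0 <= X x)%R -> Q.-integrable setT (EFin \o X) ->
  is_cond_exp P G X Y -> is_cond_exp Q G X Y.
Proof.
move=> mw w0 QE X0 QX XY.
have mwT := measurable_wrt_fun sG GT mw.
have QP : Q `<< P.
  apply/null_content_dominatesP => A mA PA; rewrite QE//.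
  by apply: null_set_integral => //; exact/measurable_EFinP/measurable_funTS.
have mX : measurable_fun setT X by apply/measurable_EFinP/(measurable_int _ QX).
have [_ mY _ _] := XY.
(* The agreement lemma wants functions nonnegative everywhere, whereas [Y] is so only almost surely;
   hence the passage to its positive part. *)
pose Z x := Num.max (Y x) 0%R.
have mZ : measurable_wrt G Z by apply: measurable_maxr.
have mZT := measurable_wrt_fun sG GT mZ.
have Z0 x : (0 <= Z x)%R by rewrite le_max lexx orbT.
have YZ : \forall x \ae P, Y x = Z x.
  apply: filterS (cond_exp_le X0 (cond_exp_cst P 0) XY) => x /= Y0.
  by rewrite /Z max_l.
have [_ _ _ PZ] := cond_exp_ae_eq XY mZ YZ.
have QZ A : G A -> \int[Q]_(x in A) (Z x)%:E = \int[Q]_(x in A) (X x)%:E.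
  move=> GA; rewrite !(integral_density mwT w0 QE)//; [|exact: GT..].
  under eq_integral do rewrite mulrC.
  under [RHS]eq_integral do rewrite mulrC.
  exact: (ge0_integralM_agree sG GT mZT Z0 mX X0 mw w0 PZ GA).
apply: (@cond_exp_ae_eq _ _ Z) => //; last first.
  by apply: (null_dominates_ae QP); apply: filterS YZ => x ->.
split=> //; apply/integrableP; split; first exact/measurable_EFinP.
have /integrableP[_] := QX.
under eq_integral do rewrite /= ger0_norm//.
move=> Xoo.
under eq_integral do rewrite /= ger0_norm//.
by rewrite QZ//; exact/(measurable_sub_sigma sG)/measurableT.
Qed.

End cond_exp.

(** * Densities and their inverses *)

Section density.
Context d (T : measurableType d) (R : realType).
Implicit Types (P Q : probability T R) (w X Y : T -> R).

(** The absolute value changes [w] only on a null set and makes it nonnegative everywhere, as the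
    lemmas on nonnegative integrands require. *)
Lemma is_density_integral P Q w : Q `<< P -> is_density Q P w ->
  measurable_fun setT w -> (\forall x \ae P, (0 < w x)%R) ->
  forall A, measurable A -> Q A = \int[P]_(x in A) (`|w x|%R)%:E.
Proof.
move=> QP Qw mw w0 A mA.
have QP' : charge_of_finite_measure Q `<< P := QP.
rewrite -[LHS]/(charge_of_finite_measure Q A) (Radon_Nikodym_integral QP' mA).
apply: ae_eq_integral => //.
- apply: measurable_funTS; exact: measurable_int (Radon_Nikodym_integrable QP').
- by apply/measurable_EFinP/measurable_funTS; exact: measurableT_comp.
- by apply: filterS2 w0 Qw => x /= wx -> // _; rewrite gtr0_norm.
Qed.

(** The inverse is taken as a real power, which is measurable and nonnegative everywhere; its value
    where [w] vanishes is irrelevant, that set being [P]-null. *)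
Lemma density_inv P Q w :
  measurable_fun setT w -> (forall x, 0 <= w x)%R ->
  (\forall x \ae P, (0 < w x)%R) ->
  (forall A, measurable A -> Q A = \int[P]_(x in A) (w x)%:E) ->
  forall A, measurable A -> P A = \int[Q]_(x in A) ((w x)`^(-1))%:E.
Proof.
move=> mw w0 wpos QE A mA.
have mv : measurable_fun setT (fun x => (w x)`^(-1))%R.
  exact: (measurableT_comp (measurable_powR _) mw).
rewrite (integral_density mw w0 QE)//; last by move=> x; exact: powR_ge0.
rewrite -[LHS]mul1e -integral_cst//.
apply: ae_eq_integral => //.
  by apply/measurable_EFinP/measurable_funTS; exact: measurable_funM.
apply: filterS wpos => x wx _ /=.
by rewrite powR_inv1 ?w0// mulVf// gt_eqF.
Qed.

(** Change of measure is applied with density [w] in one direction and with its inverse in the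
    other. *)
Lemma cond_exp_equiv (G : set (set T)) P Q w X Y :
  sigma_algebra setT G -> G `<=` @measurable d T ->
  measurable_wrt G w -> (forall x, 0 <= w x)%R ->
  (\forall x \ae P, (0 < w x)%R) ->
  (forall A, measurable A -> Q A = \int[P]_(x in A) (w x)%:E) ->
  (forall x, 0 <= X x)%R ->
  P.-integrable setT (EFin \o X) -> Q.-integrable setT (EFin \o X) ->
  is_cond_exp P G X Y <-> is_cond_exp Q G X Y.
Proof.
move=> sG GT mw w0 wpos QE X0 PX QX; split.
  exact: (cond_exp_density sG GT mw).
have mwT := measurable_wrt_fun sG GT mw.
apply: (cond_exp_density sG GT _ _ (density_inv mwT w0 wpos QE) X0 PX).
  exact: (measurableT_comp (measurable_powR _) mw).
by move=> x; exact: powR_ge0.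
Qed.

End density.

(** * Integrals and densities of mixtures *)

Section convex_hull.
Context d (T : measurableType d) (R : realType) (k : nat).
Variable P : 'I_k.+1 -> probability T R.

Lemma convex_hull_mem i : convex_hull P (P i).
Proof.
exists (fun j => (j == i)%:R); split.
- by move=> j; rewrite ler0n.
- by rewrite (bigD1 i)//= eqxx big1 ?addr0// => j /negbTE ->.
- move=> A mA; rewrite (bigD1 i)//= eqxx mul1e big1 ?adde0// => j /negbTE ->.
  by rewrite mul0e.
Qed.

Lemma ge0_integral_mixture (Q : probability T R) (a : 'I_k.+1 -> R) (u : T -> R) :
  (forall i, 0 <= a i)%R ->
  (forall A, measurable A -> Q A = \sum_(i < k.+1) (a i)%:E * P i A) ->
  measurable_fun setT u -> (forall x, 0 <= u x)%R ->
  \int[Q]_x (u x)%:E = \sum_(i < k.+1) (a i)%:E * \int[P i]_x (u x)%:E.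
Proof.
move=> a0 QE mu_ u0.
(* [msum] takes a family indexed by naturals; [inord] extends the finite family, and only indices
   below [k.+1] enter the sum. *)
pose m n := mscale (NngNum (a0 (inord n))) (P (inord n)).
rewrite (eq_measure_integral (msum m k.+1)); last first.
  move=> A mA _; rewrite /= QE// /msum; apply: eq_bigr => i _.
  by rewrite /m /mscale/= inord_val.
have mu' : measurable_fun setT (EFin \o u) by exact/measurable_EFinP.
have u0' x : setT x -> 0 <= (u x)%:E by rewrite lee_fin.
rewrite ge0_integral_measure_sum//; apply: eq_bigr => i _.
by rewrite ge0_integral_mscale//= inord_val.
Qed.

Lemma convex_hull_integral_le (Q : probability T R) (u : T -> R) (c : R) :
  convex_hull P Q -> measurable_fun setT u -> (forall x, 0 <= u x)%R ->
  (forall i, \int[P i]_x (u x)%:E <= c%:E) -> \int[Q]_x (u x)%:E <= c%:E.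
Proof.
move=> [a [a0 a1 QE]] mu_ u0 uc; rewrite (ge0_integral_mixture a0 QE)//.
rewrite -[c]mul1r -a1 mulr_suml -sumEFin; apply: lee_sum => i _.
by rewrite EFinM lee_wpmul2l// lee_fin.
Qed.

Lemma convex_hull_integral_eq (Q : probability T R) (u : T -> R) (c : R) :
  convex_hull P Q -> measurable_fun setT u -> (forall x, 0 <= u x)%R ->
  (forall i, \int[P i]_x (u x)%:E = c%:E) -> \int[Q]_x (u x)%:E = c%:E.
Proof.
move=> [a [a0 a1 QE]] mu_ u0 uc; rewrite (ge0_integral_mixture a0 QE)//.
rewrite -[c]mul1r -a1 mulr_suml -sumEFin; apply: eq_bigr => i _.
by rewrite uc EFinM.
Qed.

Lemma convex_hull_density (Q : probability T R) (G : set (set T))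
    (phi : 'I_k.+1 -> T -> R) (i0 : 'I_k.+1) :
  sigma_algebra setT G -> G `<=` @measurable d T ->
  (forall i, P i `<< P i0) -> (forall i, is_density (P i) (P i0) (phi i)) ->
  (forall i, measurable_wrt G (phi i)) ->
  (forall i, \forall x \ae P i0, (0 < phi i x)%R) ->
  convex_hull P Q ->
  exists w : T -> R, [/\ measurable_wrt G w, (forall x, 0 <= w x)%R,
    (\forall x \ae P i0, (0 < w x)%R) &
    forall A, measurable A -> Q A = \int[P i0]_(x in A) (w x)%:E].
Proof.
move=> sG GT PP0 phiP mphi phi0 [a [a0 a1 QE]].
have mphiT i := measurable_wrt_fun sG GT (mphi i).
exists (fun x => \sum_(i < k.+1) a i * `|phi i x|)%R; split.
- apply: measurable_sum => i; apply: measurable_funM => //.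
  exact: (measurableT_comp (@normr_measurable R setT) (mphi i)).
- by move=> x; rewrite sumr_ge0// => i _; rewrite mulr_ge0.
- have : \forall x \ae P i0, forall i, (0 < phi i x)%R by exact: filter_forall.
  apply: filterS => x phix; rewrite lt_neqAle eq_sym; apply/andP; split.
    (* Where every [phi i] is positive, a vanishing sum would force all weights to be 0, but they
       sum to 1. *)
    apply/negP => /eqP /psumr_eq0P a_eq0.
    have : (\sum_(i < k.+1) a i = 0 :> R)%R.
      apply: big1 => i _; apply/eqP.
      have := a_eq0 (fun i _ => mulr_ge0 (a0 i) (normr_ge0 _)) i isT.
      by move/eqP; rewrite mulf_eq0 normr_eq0 (gt_eqF (phix i)) orbF.
    by rewrite a1 => /eqP; rewrite oner_eq0.
  by rewrite sumr_ge0// => i _; rewrite mulr_ge0.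
- move=> A mA; rewrite QE//.
  under [RHS]eq_integral do rewrite -sumEFin.
  rewrite ge0_integral_sum//.
  + apply: eq_bigr => i _; under [RHS]eq_integral do rewrite EFinM.
    rewrite ge0_integralZl//.
    * by rewrite (is_density_integral (PP0 i) (phiP i)).
    * by apply/measurable_EFinP/measurable_funTS; exact: measurableT_comp.
    * by rewrite lee_fin.
  + move=> i; apply/measurable_EFinP/measurable_funTS.
    by apply: measurable_funM => //; exact: measurableT_comp.
  + by move=> i x _; rewrite lee_fin mulr_ge0.
Qed.

End convex_hull.

(** * The trivial sigma-algebra, the tower property and uniform integrability *)

Section cond_exp_facts.
Context d (T : measurableType d) (R : realType).
Implicit Types (P : probability T R) (X Y Z : T -> R).

Lemma measurable_wrt_trivial Y :
  measurable_wrt [set set0; [set: T]] Y -> forall x y, Y x = Y y.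
Proof.
move=> mY x y.
have sG : sigma_algebra [set: T] [set set0; [set: T]].
  split; first by left.
  - by move=> A [->|->]; rewrite ?setD0 ?setDv; [right|left].
  - move=> A GA; case: (pselect (exists n, A n = setT)) => [[n An]|An].
      by right; apply/seteqP; split=> // x' _; exists n => //; rewrite An.
    left; apply: bigcup0 => n _; have [//|AnT] := GA n.
    by exfalso; apply: An; exists n.
(* The preimage of the singleton contains [y], so it is not empty and must be the whole space. *)
have := (measurable_wrtP sG Y).1 mY [set Y y] (measurable_set1 _).
case=> [/seteqP[/(_ y) /= H _]|/seteqP[_ /(_ x I)]//].
by exfalso; exact: H.
Qed.

Lemma cond_exp_trivial P X : P.-integrable setT (EFin \o X) ->
  is_cond_exp P [set set0; setT] X (cst (fine (\int[P]_x (X x)%:E))).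
Proof.
move=> iX; split=> //.
- exact: measurable_cst.
- exact: finite_measure_integrable_cst.
- move=> A [->|->]; first by rewrite !integral_set0.
  by rewrite /= integral_cst//= probability_setT mule1 fineK// integrable_fin_num.
Qed.

Lemma cond_exp_tower (F G : set (set T)) P X Y Z : F `<=` G ->
  is_cond_exp P G X Y -> is_cond_exp P F X Z -> is_cond_exp P F Y Z.
Proof.
move=> FG [iX mY iY YX] [_ mZ iZ ZX]; split=> // A FA.
by rewrite ZX// YX//; exact: FG.
Qed.

Lemma cond_exp_integral (G : set (set T)) P X Y : sigma_algebra setT G ->
  is_cond_exp P G X Y -> \int[P]_x (Y x)%:E = \int[P]_x (X x)%:E.
Proof.
by move=> sG [_ _ _ ->//]; exact/(measurable_sub_sigma sG)/measurableT.
Qed.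

Lemma cond_exp_integral_norm (G : set (set T)) P X Y A :
  sigma_algebra setT G -> G `<=` @measurable d T -> (forall x, 0 <= X x)%R ->
  is_cond_exp P G X Y -> G A ->
  \int[P]_(x in A) `|Y x|%:E = \int[P]_(x in A) (X x)%:E.
Proof.
move=> sG GT X0 XY GA; have [iX mY iY YX] := XY.
have mYT := measurable_wrt_fun sG GT mY.
rewrite -YX//; apply: ae_eq_integral; first exact: GT.
- by apply/measurable_EFinP/measurable_funTS; exact: measurableT_comp.
- exact/measurable_EFinP/measurable_funTS.
- apply: filterS (cond_exp_le sG GT X0 (cond_exp_cst _ P 0) XY) => x /= Y0 _.
  by rewrite ger0_norm.
Qed.

(** Markov's inequality makes the event where [|Y|] exceeds [c'] small uniformly in [G] and [Y];
    over it [|Y|] integrates like [X], and absolute continuity of the integral of [X] concludes.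
    Allowing every [c'] above [c] lets finitely many measures share a threshold. *)
Lemma cond_exp_uniformly_integrable P X (e : R) :
  P.-integrable setT (EFin \o X) -> (forall x, 0 <= X x)%R -> (0 < e)%R ->
  exists c : R, forall c' : R, (c <= c')%R ->
    forall (G : set (set T)) Y, sigma_algebra setT G -> G `<=` @measurable d T ->
    is_cond_exp P G X Y ->
    \int[P]_(x in [set x | (c' < `|Y x|)%R]) `|Y x|%:E <= e%:E.
Proof.
move=> iX X0 e0.
have [delta [delta0 Xdelta]] := integral_normr_continuous iX e0.
pose m := fine (\int[P]_x (X x)%:E).
have mE : \int[P]_x (X x)%:E = m%:E by rewrite fineK// integrable_fin_num.
have mX : measurable_fun setT X by apply/measurable_EFinP/(measurable_int _ iX).
have m0 : (0 <= m)%R.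
  by rewrite -lee_fin -mE; apply: integral_ge0 => x _; rewrite lee_fin.
(* The added 1 keeps the threshold positive and contradicts [c' * P B <= m] as soon as [P B] reaches
   [delta]. *)
exists ((m + 1) / delta)%R => c' cc' G Y sG GT XY.
have c'0 : (0 < c')%R by apply: lt_le_trans cc'; rewrite divr_gt0// ltr_wpDl.
have [_ mY _ _] := XY.
have mYT := measurable_wrt_fun sG GT mY.
set B := [set x | _].
have GB : G B.
  apply/(measurable_sub_sigma sG).
  have := measurable_fun_ltr (measurable_cst c')
    (measurableT_comp (@normr_measurable R setT) mY)
    measurableT (I : measurable [set true]).
  by rewrite setTI.
have mB := GT _ GB.
have BX : \int[P]_(x in B) `|Y x|%:E = \int[P]_(x in B) (X x)%:E.
  exact: (cond_exp_integral_norm sG GT X0 XY GB).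
have PB : P B < delta%:E.
  have PBfin : P B \is a fin_num by exact: fin_num_measure.
  have : c'%:E * P B <= m%:E.
    rewrite -mE -integral_cst//; apply: (@le_trans _ _ (\int[P]_(x in B) `|Y x|%:E)).
      apply: ge0_le_integral => //.
      - by move=> x _; rewrite lee_fin ltW.
      - by apply/measurable_EFinP/measurable_funTS; exact: measurableT_comp.
      - by move=> x Bx; rewrite lee_fin ltW.
    rewrite BX; apply: ge0_subset_integral => //.
    - exact/measurable_EFinP.
    - by move=> x _; rewrite lee_fin.
  rewrite -(fineK PBfin) -EFinM lee_fin lte_fin => cPB.
  rewrite ltNge; apply/negP => dPB.
  have : (m + 1 <= c' * fine (P B))%R.
    rewrite -(divfK (lt0r_neq0 delta0) (m + 1)%R).
    by rewrite ler_pM// ?divr_ge0 ?addr_ge0// ltW.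
  by move=> /le_trans /(_ cPB); rewrite gerDl ler10.
rewrite BX; have := ltW (Xdelta B mB PB).
rewrite -lee_fin /Rintegral fineK//; last first.
  have iXn : P.-integrable setT (fun x => `|X x|%:E) by exact: integrable_norm.
  by apply: integrable_fin_num => //; exact: integrableS iXn.
by under eq_integral do rewrite ger0_norm//.
Qed.

End cond_exp_facts.

(** * Essential suprema of conditional expectations *)

Lemma ae_exists d (T : measurableType d) (R : realType) (P : probability T R)
    (p : T -> Prop) : (\forall x \ae P, p x) -> exists x, p x.
Proof.
move=> [A [mA PA pA]]; apply: contrapT => np.
have AT : A = setT.
  by apply/seteqP; split=> // x _; apply: pA => /= px; apply: np; exists x.
by move: PA; rewrite AT probability_setT => -[] /eqP; rewrite oner_eq0.
Qed.

(* An essential supremum can only exist if the family is nonempty, so the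
   conditional expectation itself need not be constructed. *)
Lemma ess_sup_cond_exp d (T : measurableType d) (R : realType)
    (P : probability T R) (M : set (probability T R)) (G : set (set T))
    (X f : T -> R) :
  sigma_algebra setT G -> G `<=` @measurable d T -> measurable_wrt G f ->
  (forall Q Y, M Q -> is_cond_exp P G X Y <-> is_cond_exp Q G X Y) ->
  is_ess_sup P [set h | exists2 Q, M Q & is_cond_exp Q G X h] f ->
  is_cond_exp P G X f.
Proof.
move=> sG GT mf PM [mfT fub flub].
have [h [Q MQ Qh]] : exists h, exists2 Q, M Q & is_cond_exp Q G X h.
  apply: contrapT => empty.
  (* Over an empty family [f - 1] would be an upper bound too, so [f <= f - 1] would hold at some
     point. *)
  have mf1 : measurable_fun setT (fun x => f x - 1)%R.
    exact: measurable_funB.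
  have [|x] := ae_exists (flub _ mf1 _); last by rewrite lerDl oppr_ge0 ler10.
  by move=> h Sh; exfalso; apply: empty; exists h.
have Ph : is_cond_exp P G X h by exact/(PM _ _ MQ).
have [_ mh _ _] := Ph.
apply: (cond_exp_ae_eq sG GT Ph mf).
have hf := fub h (ex_intro2 _ _ Q MQ Qh).
(* All members of the family are versions of one conditional expectation, so [h] dominates each of
   them. *)
have fh : \forall x \ae P, (f x <= h x)%R.
  apply: flub; first exact: measurable_wrt_fun mh.
  move=> h' [Q' MQ' /(PM _ _ MQ') Ph'].
  by apply: filterS (cond_exp_unique sG GT Ph' Ph) => x ->.
by apply: filterS2 hf fh => x hfx fhx; apply/eqP; rewrite eq_le hfx.
Qed.

(** * The criterion for local regularity *)

Theorem theorem2 (d : measure_display) (T : measurableType d) (R : realType)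
    (F : nat -> set (set T))
    (filtF : filtration F)
    (F0 : F 0%N = [set set0; setT])
    (Finfty : @measurable d T = <<s \bigcup_(n in [set n | (1 <= n)%N]) F n >>)
    (k : nat) (P : 'I_k.+1 -> probability T R)
    (equivP : forall i l, P i `<< P l)
    (phi : 'I_k.+1 -> 'I_k.+1 -> T -> R)
    (phi_density : forall i l, is_density (P i) (P l) (phi i l))
    (phi_meas : forall i l, measurable_wrt (F 1%N) (phi i l))
    (phi_gt0 : forall i l, P ord0 [set x | (0 < phi i l x)%R] = 1)
    (xi : {mfun T >-> R})
    (xi_ge0 : forall x, (0 <= xi x)%R)
    (xi_int : \big[maxe/-oo]_(i < k.+1) 'E_(P i)[xi] < +oo)
    (f : nat -> T -> R)
    (f_adapted : adapted F f)
    (f_ess_sup : forall m, is_ess_sup (P ord0)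
       [set h | exists2 Q, convex_hull P Q & is_cond_exp Q (F m) xi h] (f m)) :
  supermartingale (convex_hull P) F f /\
  (local_regular (convex_hull P) F f <->
   uniformly_integrable (range P) f /\
   (forall i x, 'E_(P i)[xi] = (f 0%N x)%:E)).
Proof.
have [sF FT Fincr] := filtF.
have Fmono j m : (j <= m)%N -> F j `<=` F m.
  move=> /subnK <-; elim: (m - j)%N => [//|n IH].
  by apply: subset_trans IH _; exact: Fincr.
have mxi : measurable_fun setT xi by exact: measurable_funPT.
have mxiE : measurable_fun setT (EFin \o xi) by exact/measurable_EFinP.
have intP i : (P i).-integrable setT (EFin \o xi).
  apply/integrableP; split=> //.
  under eq_integral do rewrite /= ger0_norm//.
  apply: le_lt_trans xi_int.
  have := le_bigmax -oo (fun i => 'E_(P i)[xi]) i.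
  by rewrite unlock.
pose e i := fine (\int[P i]_x (xi x)%:E).
have eE i : \int[P i]_x (xi x)%:E = (e i)%:E.
  by rewrite fineK//; apply: integrable_fin_num => //; exact: intP.
(* Any point would do: [F 0] is trivial, so [f 0] is constant. *)
pose c := f 0%N point.
have f0E x : f 0%N x = c.
  by apply: (@measurable_wrt_trivial _ _ _ (f 0%N)); rewrite -F0; exact: f_adapted.
have e_le_c i : (e i <= c)%R.
  have [_ fub _] := f_ess_sup 0%N.
  have [|x] := ae_exists (fub (cst (e i)) _); last by rewrite f0E.
  exists (P i); first exact: convex_hull_mem.
  by rewrite F0; exact: cond_exp_trivial.
have le_intQ Q : convex_hull P Q -> \int[Q]_x (xi x)%:E <= c%:E.
  move=> PQ; apply: (convex_hull_integral_le PQ) => // i.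
  by rewrite eE lee_fin.
have intQ Q : convex_hull P Q -> Q.-integrable setT (EFin \o xi).
  move=> PQ; apply/integrableP; split=> //.
  under eq_integral do rewrite /= ger0_norm//.
  by apply: le_lt_trans (le_intQ _ PQ) _; rewrite ltry.
(* The largest mean [e i0] bounds the family at time 0: each member is a constant equal to the mean
   of [xi] under some mixture. Minimality of [f 0] then gives [c <= e i0]. *)
have [i0 ei0] : exists i0, e i0 = c.
  pose i0 := [arg max_(i > ord0) e i]%O.
  have e_max i : (e i <= e i0)%R by rewrite /i0; case: arg_maxP => // j _; exact.
  exists i0; apply/eqP; rewrite eq_le e_le_c/=.
  have [_ _ flub] := f_ess_sup 0%N.
  have [//||x] := ae_exists (flub (cst (e i0)) _ _); last by rewrite f0E.
  move=> h [Q PQ]; rewrite F0 => -[_ /measurable_wrt_trivial h_cst _ Qh].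
  apply: nearW => x.
  rewrite -lee_fin; apply: (@le_trans _ _ (\int[Q]_x (xi x)%:E)); last first.
    by apply: (convex_hull_integral_le PQ) => // i; rewrite eE lee_fin.
  rewrite -Qh; last by right.
  under eq_integral do rewrite (h_cst _ x).
  by rewrite integral_cst//= probability_setT mule1.
have phi_pos i : \forall x \ae P ord0, (0 < phi i ord0 x)%R.
  have mphi := measurable_wrt_fun (sF 1%N) (FT 1%N) (phi_meas i ord0).
  have mpos : measurable [set x | (0 < phi i ord0 x)%R].
    have := measurable_fun_ltr (measurable_cst (0%R : R)) mphi measurableT
      (I : measurable [set true]).
    by rewrite setTI.
  exists (~` [set x | (0 < phi i ord0 x)%R]); split=> //; first exact: measurableC.
  by rewrite probability_setC// phi_gt0 subee.
(* The density of [Q] is measurable for [F 1], hence for [F m] once [m] is positive; at time 0 the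
   conditional expectations are the means, which may vary with [Q]. *)
have equivQ m Q Y : (0 < m)%N -> convex_hull P Q ->
    is_cond_exp (P ord0) (F m) xi Y <-> is_cond_exp Q (F m) xi Y.
  move=> m0 PQ.
  have [||w [mw w0 wpos QE]] := convex_hull_density (sF 1%N) (FT 1%N)
    (fun i => equivP i ord0) (fun i => phi_density i ord0) _ _ PQ => //.
  have mw' : measurable_wrt (F m) w.
    apply/(measurable_wrtP (sF m)) => B mB; apply: (Fmono _ _ m0).
    exact: (measurable_wrtP (sF 1%N) _).1.
  exact: (cond_exp_equiv Y (sF m) (FT m) mw' w0 wpos QE xi_ge0 (intP _) (intQ _ PQ)).
have f_cond_exp m Q : (0 < m)%N -> convex_hull P Q ->
    is_cond_exp Q (F m) xi (f m).
  move=> m0 PQ; apply/(equivQ _ _ _ m0 PQ).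
  apply: (ess_sup_cond_exp (sF m) (FT m)) (f_ess_sup m) => //.
  by move=> Q' Y PQ'; exact: equivQ.
have int_f m Q : convex_hull P Q -> Q.-integrable setT (EFin \o f m).
  case: m => [|m] PQ; last by have [] := f_cond_exp m.+1 Q isT PQ.
  have -> : f 0%N = cst c by apply/funext.
  exact: finite_measure_integrable_cst.
have integral_f m Q : (0 < m)%N -> convex_hull P Q ->
    \int[Q]_x (f m x)%:E = \int[Q]_x (xi x)%:E.
  by move=> m0 PQ; exact: cond_exp_integral (sF m) (f_cond_exp _ _ m0 PQ).
have integral_f0 (Q : probability T R) : \int[Q]_x (f 0%N x)%:E = c%:E.
  under eq_integral do rewrite f0E.
  by rewrite integral_cst//= probability_setT mule1.
have norm_f m Q : (0 < m)%N -> convex_hull P Q ->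
    'E_Q[fun x => `|f m x|%R] = \int[Q]_x (xi x)%:E.
  move=> m0 PQ; rewrite unlock.
  apply: (cond_exp_integral_norm (sF m) (FT m) xi_ge0 (f_cond_exp _ _ m0 PQ)).
  exact/(measurable_sub_sigma (sF m))/measurableT.
have f_tower j m Q : (0 < j <= m)%N -> convex_hull P Q ->
    is_cond_exp Q (F j) (f m) (f j).
  move=> /andP[j0 jm] PQ.
  apply: (cond_exp_tower (Fmono _ _ jm) _ (f_cond_exp _ _ j0 PQ)).
  by apply: f_cond_exp PQ; exact: leq_trans jm.
have super : supermartingale (convex_hull P) F f.
  split=> // [m Q m0 PQ|[|j] m Q jm PQ].
  - by rewrite norm_f//; apply: le_lt_trans (le_intQ _ PQ) _; rewrite ltry.
  - exists (cst (fine (\int[Q]_x (f m x)%:E))).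
      by rewrite F0; apply: cond_exp_trivial; exact: int_f.
    (* From time 0, the claim compares means: that of [f m] is [c] or the [Q]-mean of [xi], which is
       at most [c]. *)
    apply: nearW => x; rewrite f0E -lee_fin fineK; last first.
      by apply: integrable_fin_num => //; exact: int_f.
    by case: m {jm} => [|m]; rewrite ?integral_f0// integral_f//; exact: le_intQ.
  - by exists (f j.+1); [exact: f_tower|exact: nearW].
split=> //; split=> [[_ _ [g [g_adapted g0 _ g00 [g_mean mart]]]]|[_ ef]].
  split.
    move=> eps eps0.
    have /fin_all_exists[K KP] : forall i, exists K : R, forall K' : R, (K <= K')%R ->
        forall (G : set (set T)) Y, sigma_algebra setT G ->
          G `<=` @measurable d T -> is_cond_exp (P i) G xi Y ->
        \int[P i]_(x in [set x | (K' < `|Y x|)%R]) `|Y x|%:E <= eps%:E.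
      by move=> i; exact: cond_exp_uniformly_integrable.
    (* The term [|c|] empties the event at time 0, where [f 0] is the constant [c]; the sum
       dominates every individual threshold [K i]. *)
    exists (`|c| + \sum_i `|K i|)%R => _ m [i _ <-].
    have K0 : (0 <= \sum_i `|K i|)%R by exact: sumr_ge0.
    case: m => [|m].
      rewrite [X in integral _ X _](_ : _ = set0) ?integral_set0 ?lee_fin ?ltW//.
      apply/seteqP; split=> // x /=; rewrite f0E => /lt_le_trans.
      by move=> /(_ `|c|%R); rewrite lexx ltNge lerDl K0 => /(_ isT).
    apply: (KP i _ _ _ _ (sF m.+1) (FT m.+1)
      (f_cond_exp m.+1 _ isT (convex_hull_mem P i))).
    rewrite (bigD1 i)//= addrCA; apply: (le_trans (ler_norm _)).
    by rewrite lerDl addr_ge0// sumr_ge0.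
  have mg : measurable_fun setT (g 1%N).
    exact: (measurable_wrt_fun (sF 1%N) (FT 1%N)).
  have int_g i : (P i).-integrable setT (EFin \o g 1%N).
    apply/integrableP; split; first exact/measurable_EFinP.
    apply: le_lt_trans (g_mean 1%N isT); apply: ereal_sup_ubound.
    by exists (P i); [exact: convex_hull_mem|rewrite unlock].
  (* Equality of the means of [f + g] at times 0 and 1, with [g 0 = 0] and [f 1] having the mean of
     [xi]. *)
  have ge i : (e i)%:E + \int[P i]_x (g 1%N x)%:E = c%:E.
    have [_ _ /(_ 0%N 1%N isT)] := mart _ (convex_hull_mem P i).
    move=> /(cond_exp_integral (sF 0%N)).
    under eq_integral do rewrite g00 addr0.
    rewrite integral_f0 => ->.
    rewrite -eE -(integral_f 1%N)//; last exact: convex_hull_mem.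
    rewrite -integralD_EFin//; last exact: int_g.
    exact: (int_f 1%N _ (convex_hull_mem P i)).
  have g1_i0 : \int[P i0]_x (g 1%N x)%:E = 0.
    have := ge i0; rewrite ei0.
    have : \int[P i0]_x (g 1%N x)%:E \is a fin_num.
      by apply: integrable_fin_num => //; exact: int_g.
    by case: integral => // r _ [] /eqP;
      rewrite -subr_eq0 addrAC subrr add0r => /eqP ->.
  have g1_ae : ae_eq (P i0) setT (EFin \o g 1%N) (cst 0).
    apply/(ae_eq_integral_abs _ measurableT); first exact/measurable_EFinP.
    by rewrite -[RHS]g1_i0; apply: eq_integral => x _ /=; rewrite ger0_norm.
  move=> i x; rewrite unlock f0E eE -(ge i).
  rewrite (ae_eq_integral (cst 0) (EFin \o g 1%N))// ?integral0 ?adde0//.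
    exact/measurable_EFinP.
  exact: null_dominates_ae_eq (equivP i i0) g1_ae.
have xiQ Q : convex_hull P Q -> \int[Q]_x (xi x)%:E = c%:E.
  move=> PQ; apply: (convex_hull_integral_eq PQ) => // i.
  by have := ef i point; rewrite unlock.
split=> //.
  move=> m m0; apply: (@le_lt_trans _ _ c%:E); last by rewrite ltry.
  by apply: ub_ereal_sup => _ [Q PQ <-]; rewrite norm_f// xiQ.
exists (fun _ _ => 0%R); split=> //.
- by move=> m; exact: measurable_cst.
- by move=> x m n _.
- split.
    move=> m m0; apply: (@le_lt_trans _ _ 0); last by rewrite ltry.
    apply: ub_ereal_sup => _ [Q PQ <-]; rewrite unlock.
    by under eq_integral do rewrite normr0; rewrite integral0.
  move=> Q PQ; have -> : (fun m x => f m x + 0)%R = f.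
    by apply/funext => m; apply/funext => x; rewrite addr0.
  split=> // [m|[|j] m jm]; first exact: int_f.
    (* Equal means make [c] the [Q]-mean of every [f m], which extends the martingale property down
       to time 0. *)
    have -> : f 0%N = cst (fine (\int[Q]_x (f m x)%:E)).
      apply/funext => x; rewrite f0E.
      by case: m {jm} => [|m]; rewrite ?integral_f0// integral_f// xiQ.
    by rewrite F0; apply: cond_exp_trivial; exact: int_f.
  exact: f_tower.
Qed.
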